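(* Let $\mathcal{D}$ be a domain in a (real or complex) Banach space $X$, let $\mathcal{A}$ be a complex unital Banach algebra, let $\mathcal{F}=\{F_t\}_{t\ge 0}\subset C(\mathcal{D})$ be a semigroup on $\mathcal{D}$, and let $\{\Gamma_t\}_{t\ge 0}\subset C(\mathcal{D},\mathcal{A})$ be a semicocycle over $\mathcal{F}$. Then $\{\Gamma_t\}_{t\ge0}$ is jointly continuous on $(0,\infty)\times\mathcal{D}$. If, moreover, $\mathcal{F}$ is jointly continuous on $[0,\infty)\times\mathcal{D}$, then $\{\Gamma_t\}_{t\ge 0}$ is jointly continuous on $[0,\infty)\times\mathcal{D}$.
   Context: A domain is a connected open set. $C(\mathcal{D},\mathcal{A})$ is the set of continuous maps $\mathcal{D}\to\mathcal{A}$ (norm topologies), and $C(\mathcal{D})$ the set of continuous self-maps of $\mathcal{D}$. The unit $1_{\mathcal{A}}$ of $\mathcal{A}$ satisfies $\|1_{\mathcal{A}}\|=1$. Semigroup on $\mathcal{D}$: a family $\{F_t\}_{t\ge0}\subset C(\mathcal{D})$ with (i) $F_{t+s}=F_t\circ F_s$ for all $t,s\ge 0$; (ii) $\lim_{t\to0^+}F_t(x)=x$ for every $x\in\mathcal{D}$. Semicocycle over $\{F_t\}$: a family of maps $\Gamma_t:\mathcal{D}\to\mathcal{A}$, $t\ge0$, with (a) $\Gamma_t(F_s(x))\Gamma_s(x)=\Gamma_{t+s}(x)$ for all $t,s\ge0$, $x\in\mathcal{D}$; (b) $\lim_{t\to0^+}\Gamma_t(x)=1_{\mathcal{A}}$ for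 every $x\in\mathcal{D}$. A family $\{f_t\}_{t\ge0}$ of maps from $\mathcal{D}$ to a Banach space is jointly continuous on $I\times\mathcal{D}$ ($I\subset[0,\infty)$ an interval) if $\lim_{t\to t_0,\,x\to x_0}f_t(x)=f_{t_0}(x_0)$ for every $(t_0,x_0)\in I\times\mathcal{D}$. *)

(* Defs.v *)
From HB Require Import structures.
From mathcomp Require Import all_boot all_order all_algebra complex.
From mathcomp Require Import all_classical all_reals.
From mathcomp Require Import topology normedtype.

Set Implicit Arguments.
Unset Strict Implicit.
Unset Printing Implicit Defensive.

Import Order.TTheory GRing.Theory Num.Theory.
Import numFieldNormedType.Exports.

Local Open Scope classical_set_scope.
Local Open Scope ring_scope.

(* A Banach space with a bilinear, associative, unital, submultiplicative
   product.  HB cannot declare the join of GRing.Algebra and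
   CompleteNormedModule (Num.NumDomain already inherits from rings and normed
   Z-modules); so the product is packaged as a record and the algebra instance
   is put on its carrier. *)
Record banachAlgType (K : numFieldType) := BanachAlg {
  banach_space : completeNormedModType K ;
  banach_one : banach_space ;
  banach_mul : banach_space -> banach_space -> banach_space ;
  banach_mulA : associative banach_mul ;
  banach_mul1l : left_id banach_one banach_mul ;
  banach_mul1r : right_id banach_one banach_mul ;
  banach_mulDl : left_distributive banach_mul +%R ;
  banach_mulDr : right_distributive banach_mul +%R ;
  banach_scaleAl : forall (a : K) x y,
    a *: banach_mul x y = banach_mul (a *: x) y ;
  banach_scaleAr : forall (a : K) x y,
    a *: banach_mul x y = banach_mul x (a *: y) ;
  banach_normM : forall x y, `|banach_mul x y| <= `|x| * `|y| ;
  banach_norm1 : `|banach_one| = 1 }.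

Definition banach_sort (K : numFieldType) (A : banachAlgType K) : Type :=
  banach_space A.
Coercion banach_sort : banachAlgType >-> Sortclass.

Section BanachAlgInstances.
Variables (K : numFieldType) (A : banachAlgType K).

Lemma banach_oner_neq0 : banach_one A != 0.
Proof. by rewrite -normr_eq0 banach_norm1 oner_neq0. Qed.

HB.instance Definition _ :=
  CompleteNormedModule.copy (banach_sort A) (banach_space A).
HB.instance Definition _ := GRing.Zmodule_isNzRing.Build (banach_sort A)
  (@banach_mulA K A) (@banach_mul1l K A) (@banach_mul1r K A)
  (@banach_mulDl K A) (@banach_mulDr K A) banach_oner_neq0.
HB.instance Definition _ :=
  GRing.Lmodule_isLalgebra.Build K (banach_sort A) (@banach_scaleAl K A).
HB.instance Definition _ :=
  GRing.Lalgebra_isAlgebra.Build K (banach_sort A) (@banach_scaleAr K A).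

End BanachAlgInstances.

Variant scalars := RealScalars | ComplexScalars.

Definition scalar_field (R : realType) (k : scalars) : numFieldType :=
  match k with RealScalars => R | ComplexScalars => R[i] end.

Definition is_domain (X : topologicalType) (D : set X) : Prop :=
  open D /\ connected D.

(* Families indexed by t >= 0 of maps defined on D are encoded as total
   functions R -> X -> Y; nothing is assumed for t < 0 or outside D. *)

Definition is_semigroup (R : realType) (X : topologicalType) (D : set X)
    (F : R -> X -> X) : Prop :=
  [/\ forall t, 0 <= t -> set_fun D D (F t),
      forall t, 0 <= t -> {within D, continuous (F t)},
      forall t s x, 0 <= t -> 0 <= s -> D x -> F (t + s) x = F t (F s x)
    & forall x, D x -> F t x @[t --> 0^'+] --> x].

Definition is_semicocycle (R : realType) (X : topologicalType)
    (A : banachAlgType R[i]) (D : set X) (F : R -> X -> X)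
    (Gam : R -> X -> A) : Prop :=
  (forall t s x, 0 <= t -> 0 <= s -> D x ->
     Gam t (F s x) * Gam s x = Gam (t + s) x) /\
  (forall x, D x -> Gam t x @[t --> 0^'+] --> (1 : A)).

Definition jointly_continuous (R : realType) (X Y : topologicalType)
    (I : set R) (D : set X) (f : R -> X -> Y) : Prop :=
  forall t0 x0, I t0 -> D x0 ->
    f z.1 z.2 @[z --> within (I `*` D) (nbhs (t0, x0))] --> f t0 x0.

(* Main.v *)
(** Fix x0. Each map f = F, Gam is right-continuous in t and continuous in x, so
    two applications of Baire's theorem on the time line give arbitrarily small
    u > 0 such that f is jointly continuous at (u, x0). The identities
    F_t = F_(t-u) o F_u and Gam_t = (Gam_(t-u) o F_u) * Gam_u carry joint
    continuity from (u, x0) to (t, x0) for every t > u. At t = 0, if F is jointly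
    continuous, then Gam_u(F_t x) * Gam_t(x) = Gam_(t+u)(x), where Gam_u(F_t x)
    is close to 1 and Gam_u(F_t x), Gam_(t+u)(x) have the same limit, which
    forces Gam_t(x) --> 1. *)

Require Import Defs.
From mathcomp Require Import all_boot all_order all_algebra complex.
From mathcomp Require Import all_classical all_reals.
From mathcomp Require Import topology normedtype.
From mathcomp Require Import sequences.

Set Implicit Arguments.
Unset Strict Implicit.
Unset Printing Implicit Defensive.

Import Order.TTheory GRing.Theory Num.Theory.
Import numFieldNormedType.Exports.

Local Open Scope classical_set_scope.
Local Open Scope ring_scope.

(** * Archimedean scalar fields *)

Lemma archimedean_inv_lt (K : numFieldType) (e : K) :
  Num.archimedean_axiom K -> 0 < e -> exists n : nat, n.+1%:R^-1 < e.
Proof.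
move=> archK e0; have [n] := archK e^-1; rewrite gtr0_norm ?invr_gt0// => en.
exists n; rewrite -[ltRHS]invrK ltf_pV2 ?posrE ?invr_gt0 ?ltr0n//.
by rewrite (lt_le_trans en)// ler_nat.
Qed.

Lemma archimedean_complex (R : realType) : Num.archimedean_axiom R[i].
Proof.
move=> z; rewrite normc_def; set x := Num.sqrt _.
exists (Num.bound x); rewrite -(rmorph_nat (real_complex R)) ltcR.
by rewrite archi_boundP// sqrtr_ge0.
Qed.

(** Distances take values in the scalar field, real or complex. The Archimedean property supplies
    the countable family of radii [n.+1%:R^-1] on which the Baire arguments rely. *)
Lemma archimedean_scalar_field (R : realType) (k : scalars) :
  Num.archimedean_axiom (scalar_field R k).
Proof.
case: k => /= [x|]; last exact: archimedean_complex.
by exists (Num.bound `|x|); rewrite archi_boundP.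
Qed.

(** * Baire's theorem for countable covers; one-sided neighbourhoods *)

Lemma baire_cover (R : realType) (U : completeNormedModType R)
    (P : (set U)^nat) (O : set U) : open O -> O !=set0 ->
    O `<=` \bigcup_i P i ->
  exists i, exists O', [/\ open O', O' !=set0, O' `<=` O & O' `<=` closure (P i)].
Proof.
move=> oO O0 OP; apply: contrapT => noO'.
(* Thanks to the intersection with [O], a nonempty open [V] inside the closure must meet [O], so [V]
   cut down to [O] would contradict [noO']. *)
have odC i : open (~` closure (P i `&` O)) /\ dense (~` closure (P i `&` O)).
  split; first exact/closed_openC/closed_closure.
  move=> V V0 oV; apply: contrapT => VC.
  have VPO : V `<=` closure (P i `&` O).
    by move=> x Vx; apply: contrapT => xC; apply: VC; exists x.
  apply: noO'; exists i, (V `&` O); split; first exact: openI.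
  - have [x Vx] := V0.
    by have [y [[_ Oy] Vy]] := VPO x Vx V (open_nbhs_nbhs (conj oV Vx)); exists y.
  - exact: subIsetr.
  - move=> x [/VPO + _]; apply: closure_subset; exact: subIsetl.
have [x [Ox xC]] := Baire odC O0 oO.
have [i _ Pix] := OP _ Ox.
by apply: (xC i I); exact: subset_closure.
Qed.

Lemma at_right_open (R : realType) (t : R) (W O : set R) :
    nbhs t^'+ W -> open O -> O t ->
  exists O', [/\ open O', O' !=set0, O' `<=` O & O' `<=` W].
Proof.
move=> tW oO Ot; pose B := [set u | t < u -> W u].
exists (B^° `&` O `&` [set u | t < u]); split.
- apply: openI; last exact: open_gt.
  by apply: openI => //; exact: open_interior.
- have tBO : nbhs t (B^° `&` O).
    by apply: filterI; [exact: nbhs_interior|exact: open_nbhs_nbhs].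
  apply: (@filter_ex _ t^'+ _); apply: filterI; last exact: nbhs_right_gt.
  exact: cvg_within tBO.
- by move=> u [[]].
- by move=> u [[/interior_subset Bu _] /Bu].
Qed.

(** * Joint continuity at a dense set of times *)

Section generic_joint_continuity.
Context {R : realType} {K L : numFieldType}.
Context {X : pseudoMetricType K} {Y : pseudoMetricType L}.
Variables (D : set X) (f : R -> X -> Y) (x0 : X).
Hypotheses (archK : Num.archimedean_axiom K) (archL : Num.archimedean_axiom L).
Hypothesis Dx0 : D x0.
Hypothesis f_right : forall t x, 0 <= t -> D x -> f s x @[s --> t^'+] --> f t x.
Hypothesis f_within :
  forall t, 0 <= t -> f t x @[x --> within D (nbhs x0)] --> f t x0.

Let small_osc (e : L) (O : set R) : Prop :=
  open O /\ exists y, exists2 V, within D (nbhs x0) V &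
    forall s x, O s -> V x -> D x -> ball y e (f s x).

(* With continuity from the right in place of continuity, the sets [P m] need
   not be closed; a right limit of times in [P m] still costs only [e]. *)
Let small_osc_dense (e : L) (O : set R) : 0 < e -> open O -> O !=set0 ->
  O `<=` [set t | 0 <= t] -> exists O', [/\ small_osc e O', O' !=set0 & O' `<=` O].
Proof.
(* A quarter of [e], for the four links of the chain [f t x0], [f s x0], [f u x0], [f u x],
   [f s x]. *)
move=> e0 oO O0 Oge0; pose d := e / 2 / 2.
have d0 : 0 < d by rewrite !divr_gt0.
pose P m := [set t | forall x, ball x0 m.+1%:R^-1 x -> D x ->
  ball (f t x0) d (f t x)].
have OP : O `<=` \bigcup_m P m.
  move=> t /Oge0 t0; have /cvg_ballP /(_ d d0) := f_within t0.
  move=> /nbhs_ballP[r /= r0 rP]; have [m mr] := archimedean_inv_lt archK r0.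
  by exists m => // x mx Dx; apply: rP => //; exact: le_ball (ltW mr) _ mx.
have [m [O' [oO' [t O't] O'O O'P]]] := baire_cover (U := R^o) oO O0 OP.
have near_ball s x : 0 <= s -> D x -> \forall u \near s^'+, ball (f s x) d (f u x).
  by move=> s0 Dx; have /cvg_ballP := f_right s0 Dx; exact.
have [O1 [oO1 O10 O1O' O1t]] :=
  at_right_open (near_ball t x0 (Oge0 _ (O'O _ O't)) Dx0) oO' O't.
exists O1; split => //; last exact: subset_trans O'O.
split=> //; exists (f t x0), (ball x0 m.+1%:R^-1).
  have x0B : nbhs x0 (ball x0 m.+1%:R^-1) by apply: nbhsx_ballx; rewrite invr_gt0.
  exact: cvg_within x0B.
move=> s x O1s mx Dx; have s0 : 0 <= s by exact/Oge0/O'O/O1O'.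
have [O2 [oO2 [u1 O2u1] O2O1 O2s]] :=
  at_right_open (filterI (near_ball s x0 s0 Dx0) (near_ball s x s0 Dx)) oO1 O1s.
(* The set [O2] depends on [x], but the radius [m.+1%:R^-1] does not: density of [P m] in [O']
   yields a suitable [u] just to the right of [s] for every [x] in one fixed ball. *)
have [u [Pmu O2u]] := O'P _ (O1O' _ (O2O1 _ O2u1)) O2 (open_nbhs_nbhs (conj oO2 O2u1)).
have [su0 su] := O2s u O2u.
apply: (@ball_split _ _ (f u x0)).
  by apply: (@ball_split _ _ (f s x0)) => //; exact: O1t.
by apply: (@ball_split _ _ (f u x)); [exact: Pmu|exact: ball_sym].
Qed.

(** For each [n], the nonnegative times near which [f] oscillates little around [x0] contain a dense
    open family; at a time common to all [n] the oscillation at [(t, x0)] vanishes. *)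
Lemma generic_joint_continuity (a b : R) : 0 <= a -> a < b ->
  exists2 t, a < t < b &
    f z.1 z.2 @[z --> filter_prod (nbhs t) (within D (nbhs x0))] --> f t x0.
Proof.
move=> a0 ab; pose e n : L := n.+1%:R^-1.
pose G n : set R := \bigcup_(O in small_osc (e n)) O.
(* Nothing is known about [f] at negative times; adding them all makes the sets dense in the whole
   line, and [a >= 0] discards them at the end. *)
pose neg : set R := [set t | t < 0].
have odG n : open (neg `|` G n) /\ dense (neg `|` G n).
  split; first by apply: openU; [exact: open_lt|apply: bigcup_open => O [oO _]].
  move=> O O0 oO; have [[t [Ot t0]]|Oneg] := pselect (O `&` neg !=set0).
    by exists t; split => //; left.
  have Oge0 : O `<=` [set t | 0 <= t].
    by move=> t Ot /=; rewrite leNgt; apply/negP => t0; apply: Oneg; exists t.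
  have [|O' [sO' [t O't] O'O]] := small_osc_dense (e := e n) _ oO O0 Oge0.
    by rewrite invr_gt0.
  by exists t; split; [exact: O'O|right; exists O'].
have ab0 : `]a, b[%classic !=set0.
  by exists ((a + b) / 2); rewrite /= in_itv/= !midf_lt.
have oab : open (`]a, b[%classic : set R) by exact: interval_open.
have [t [/= tab tG]] := Baire (U := R^o) odG ab0 oab.
move: tab; rewrite in_itv/= => tab; exists t => //.
have {}tG n : G n t.
  have [/= t0|//] := tG n I.
  by have := lt_trans (le_lt_trans a0 (andP tab).1) t0; rewrite ltxx.
apply/cvg_ballP => eps eps0.
have [n neps] := archimedean_inv_lt archL (divr_gt0 eps0 (ltr0Sn _ 1)).
have [O [oO [y [V DV OV]]] Ot] := tG n.
exists (O, V `&` D) => /=.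
  split; first exact: open_nbhs_nbhs.
  by apply: filterI => //; exact: withinT.
have Vx0 : V x0 by exact: (nbhs_singleton DV).
move=> [s x] /= [Os [Vx Dx]].
apply: (@ball_split _ _ y); [apply: ball_sym|];
  by apply: (le_ball (ltW neps)); exact: OV.
Qed.

End generic_joint_continuity.

(** * Limits along restricted filters, products and time shifts *)

Lemma within_continuous_cvg (T U : topologicalType) (D : set T) (f : T -> U)
    (x : T) : {within D, continuous f} -> D x ->
  f y @[y --> within D (nbhs x)] --> f x.
Proof. by move=> cf Dx; have := cf x; rewrite /continuous_at nbhs_subspace_in. Qed.

Lemma cvg_in_within (T : Type) (U : topologicalType) (G : set_system T)
    {FG : Filter G} (D : set U) (f : T -> U) (x : U) :
    f y @[y --> G] --> x -> (\forall y \near G, D (f y)) ->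
  f y @[y --> G] --> within D (nbhs x).
Proof.
by move=> fx Df V /fx /= GV; apply: filterS (filterI GV Df) => y [+ Dfy]; exact.
Qed.

Lemma at_right_cvg_add (R : realType) (T : Type) (f : R -> T) (t : R)
    (G : set_system T) :
  f (t + h) @[h --> 0^'+] --> G -> f s @[s --> t^'+] --> G.
Proof. by move=> fG V /fG GV; apply/nbhs_right0P. Qed.

Lemma cvg_banachM (R : realType) (A : banachAlgType R[i]) (T : Type)
    (G : set_system T) {FG : Filter G} (f g : T -> A) (a b : A) :
    f x @[x --> G] --> a -> g x @[x --> G] --> b ->
  f x * g x @[x --> G] --> a * b.
Proof.
move=> /cvgrPdist_lt fa /cvgrPdist_lt gb; apply/cvgrPdist_lt => e e0.
(* Near the limit [f x] has norm at most [|a| + 1], so the two terms of the splitting below add up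
   to less than [e / c] times [c]. *)
pose c := `|b| + (`|a| + 1).
have c0 : 0 < c by rewrite /c ltr_wpDl// ltr_wpDl.
have d0 : 0 < e / c by rewrite divr_gt0.
near=> x.
have fx : `|a - f x| < e / c by near: x; exact: fa.
have fx1 : `|a - f x| < 1 by near: x; exact: fa.
have gx : `|b - g x| < e / c by near: x; exact: gb.
have -> : a * b - f x * g x = (a - f x) * b + f x * (b - g x).
  by rewrite mulrBl mulrBr addrA subrK.
have fxa : `|f x| <= `|a| + 1.
  by rewrite -[f x](subKr a) (le_trans (ler_normB _ _))// lerD2l ltW.
rewrite (le_lt_trans (ler_normD _ _))//.
rewrite (le_lt_trans (lerD (banach_normM _ _) (banach_normM _ _)))//.
rewrite -(divfK (lt0r_neq0 c0) e) {2}/c mulrDr ler_ltD//.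
  by rewrite ler_wpM2r// ltW.
rewrite (le_lt_trans (ler_wpM2r _ fxa))// mulrC ltr_pM2r//.
by rewrite ltr_wpDl.
Unshelve. all: by end_near. Qed.

Lemma cvg_shift_within (R : realType) (X : topologicalType) (D : set X)
    (t r : R) (x : X) :
  (z.1 - r, z.2) @[z --> filter_prod (nbhs t) (within D (nbhs x))]
  --> filter_prod (nbhs (t - r)) (within D (nbhs x)).
Proof.
have sr : z.1 - r @[z --> filter_prod (nbhs t) (within D (nbhs x))] --> t - r.
  by apply: cvgB; [exact: cvg_fst|exact: cvg_cst].
exact: cvg_pair sr cvg_snd.
Qed.

Lemma near_gt_within (R : realType) (X : topologicalType) (D : set X)
    (t r : R) (x : X) : r < t ->
  \forall z \near filter_prod (nbhs t) (within D (nbhs x)), r < z.1 /\ D z.2.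
Proof.
move=> rt; exists ([set s | r < s], D) => //=; split; first exact: lt_nbhsr.
exact: withinT.
Qed.

(** * The semigroup at positive times *)

Section semigroup.
Context {R : realType} {k : scalars} {X : completeNormedModType (scalar_field R k)}.
Variables (D : set X) (F : R -> X -> X).
Hypothesis hF : is_semigroup D F.

Lemma semigroup_in (t : R) x : 0 <= t -> D x -> D (F t x).
Proof. by case: hF => FD _ _ _ t0; exact: FD. Qed.

Lemma semigroup_within (t : R) x : 0 <= t -> D x ->
  F t y @[y --> within D (nbhs x)] --> F t x.
Proof. by case: hF => _ Fc _ _ t0; exact/within_continuous_cvg/Fc. Qed.

Lemma semigroup_right (t : R) x : 0 <= t -> D x -> F s x @[s --> t^'+] --> F t x.
Proof.
move=> t0 Dx; case: hF => _ _ FA F1; apply: at_right_cvg_add.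
apply: cvg_trans (F1 _ (semigroup_in t0 Dx)); apply: near_eq_cvg; near=> h.
by rewrite addrC FA.
Unshelve. all: by end_near. Qed.

(** Both sides are the limit of [F s x] as [s] decreases to 0. *)
Lemma semigroup0 x : D x -> F 0 x = x.
Proof.
move=> Dx; case: hF => _ _ _ /(_ x Dx) Fx.
exact: (cvg_unique (@norm_hausdorff _ _) (semigroup_right (lexx 0) Dx) Fx).
Qed.

Lemma semigroup_joint (t : R) x : 0 < t -> D x ->
  F z.1 z.2 @[z --> filter_prod (nbhs t) (within D (nbhs x))] --> F t x.
Proof.
move=> t0 Dx.
have [u /andP[u0 ut] Fu] := generic_joint_continuity
  (@archimedean_scalar_field _ _) (@archimedean_scalar_field _ _) Dx
  semigroup_right (fun (t : R) t0 => semigroup_within t0 Dx) (lexx 0) t0.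
have r0 : 0 < t - u by rewrite subr_gt0.
case: (hF) => _ _ FA _.
(* Times near [t] exceed [t - u], so the shifted time [z.1 - (t - u)] is positive and the semigroup
   law applies. *)
have rt : t - u < t by rewrite ltrBlDr ltrDl.
have -> : F t x = F (t - u) (F u x) by rewrite -FA ?subrK// ltW.
have Fz : F (z.1 - (t - u)) z.2 @[z --> filter_prod (nbhs t) (within D (nbhs x))]
    --> within D (nbhs (F u x)).
  apply: cvg_in_within.
    have := @cvg_shift_within R X D t (t - u) x; rewrite subKr => sh.
    exact: cvg_comp sh Fu.
  apply: filterS (near_gt_within D x rt) => z [z1 Dz].
  by apply: semigroup_in => //; rewrite subr_ge0 ltW.
apply: cvg_trans (cvg_comp _ _ Fz (semigroup_within (ltW r0) (semigroup_in (ltW u0) Dx))).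
apply: near_eq_cvg.
apply: filterS (near_gt_within D x rt) => z [z1 Dz] /=.
by rewrite -FA ?(ltW r0) ?subr_ge0 ?(ltW z1) ?subrKC.
Qed.

(** * The semicocycle at positive times *)

Section semicocycle.
Context {A : banachAlgType R[i]}.
Variable Gam : R -> X -> A.
Hypothesis hGamC : forall t, 0 <= t -> {within D, continuous (Gam t)}.
Hypothesis hGam : is_semicocycle D F Gam.

Lemma semicocycle_within (t : R) x : 0 <= t -> D x ->
  Gam t y @[y --> within D (nbhs x)] --> Gam t x.
Proof. by move=> t0; exact/within_continuous_cvg/hGamC. Qed.

Lemma semicocycle_right (t : R) x : 0 <= t -> D x ->
  Gam s x @[s --> t^'+] --> Gam t x.
Proof.
move=> t0 Dx; case: hGam => GA G1; apply: at_right_cvg_add.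
have G1t : Gam h (F t x) * Gam t x @[h --> 0^'+] --> Gam t x.
  rewrite -[X in _ --> X]mul1r.
  by apply: cvg_banachM; [exact/G1/semigroup_in|exact: cvg_cst].
apply: cvg_trans G1t; apply: near_eq_cvg; near=> h.
by rewrite addrC GA.
Unshelve. all: by end_near. Qed.

Lemma semicocycle0 x : D x -> Gam 0 x = 1.
Proof.
move=> Dx; case: hGam => _ /(_ x Dx) Gx.
exact: (cvg_unique (@norm_hausdorff _ A) (semicocycle_right (lexx 0) Dx) Gx).
Qed.

(** The time [u] is chosen for [Gam] alone: [F] is jointly continuous at [(u, x)] anyway, by
    [semigroup_joint], as [u > 0]. *)
Lemma semicocycle_joint (t : R) x : 0 < t -> D x ->
  Gam z.1 z.2 @[z --> filter_prod (nbhs t) (within D (nbhs x))] --> Gam t x.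
Proof.
move=> t0 Dx.
have [u /andP[u0 ut] Gu] := generic_joint_continuity
  (@archimedean_scalar_field _ _) (@archimedean_complex _) Dx
  semicocycle_right (fun (t : R) t0 => semicocycle_within t0 Dx) (lexx 0) t0.
have r0 : 0 < t - u by rewrite subr_gt0.
have rt : t - u < t by rewrite ltrBlDr ltrDl.
case: (hGam) => GA _.
have -> : Gam t x = Gam (t - u) (F u x) * Gam u x by rewrite GA ?subrK// ltW.
have sh := @cvg_shift_within R X D t (t - u) x; rewrite subKr in sh.
have Fz : F (z.1 - (t - u)) z.2 @[z --> filter_prod (nbhs t) (within D (nbhs x))]
    --> within D (nbhs (F u x)).
  apply: cvg_in_within; first exact: cvg_comp sh (semigroup_joint u0 Dx).
  apply: filterS (near_gt_within D x rt) => z [z1 Dz].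
  by apply: semigroup_in => //; rewrite subr_ge0 ltW.
have Gz := cvg_comp _ _ Fz
  (semicocycle_within (ltW r0) (semigroup_in (ltW u0) Dx)).
apply: cvg_trans (cvg_banachM Gz (cvg_comp _ _ sh Gu)).
apply: near_eq_cvg.
apply: filterS (near_gt_within D x rt) => z [z1 Dz] /=.
by rewrite GA ?(ltW r0) ?subr_ge0 ?(ltW z1) ?subrKC.
Qed.

End semicocycle.

End semigroup.

(** * Joint continuity up to time 0 *)

Lemma cvg_prod_within (T U V : topologicalType) (I : set T) (D : set U)
    (f : T * U -> V) (t : T) (x : U) (l : V) :
    f z @[z --> filter_prod (nbhs t) (within D (nbhs x))] --> l ->
  f z @[z --> within (I `*` D) (nbhs (t, x))] --> l.
Proof.
move=> fl W /fl [[P Q] /= [tP xQ] PQ]; exists (P, [set y | D y -> Q y]) => //.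
by move=> [s y] /= [Ps Qy] [_ Dy]; apply: (PQ (s, y)); split => //; exact: Qy.
Qed.

Theorem theorem3p1 (R : realType) (k : scalars)
    (X : completeNormedModType (scalar_field R k)) (D : set X)
    (A : banachAlgType R[i]) (F : R -> X -> X) (Gam : R -> X -> A)
    (hD : is_domain D) (hF : is_semigroup D F)
    (hGamC : forall t, 0 <= t -> {within D, continuous (Gam t)})
    (hGam : is_semicocycle D F Gam) :
  jointly_continuous `]0, +oo[ D Gam /\
  (jointly_continuous `[0, +oo[ D F -> jointly_continuous `[0, +oo[ D Gam).
Proof.
split=> [t x /=|jF t x /=]; rewrite in_itv/= andbT => t0 Dx.
  exact/cvg_prod_within/(semicocycle_joint hF hGamC hGam t0 Dx).
move: t0; rewrite le_eqVlt => /orP[/eqP <-{t}|t0]; last first.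
  exact/cvg_prod_within/(semicocycle_joint hF hGamC hGam t0 Dx).
rewrite (semicocycle0 hF hGam Dx).
set G := within _ _.
have half0 : 0 < 2^-1 :> R[i] by rewrite invr_gt0.
(* The bound 1/2 persists for [Gam u (F z.1 z.2)] near [(0, x)]; it lets the term
   [(1 - a) * (1 - g)] be absorbed into half of [|1 - g|] at the end. *)
have [u [u0 u1]] : exists u : R, 0 < u /\ `|1 - Gam u x| < 2^-1.
  case: hGam => _ /(_ x Dx)/cvgrPdist_lt/(_ _ half0) G1.
  apply: (@filter_ex _ (0 : R)^'+); apply: filterI G1.
  exact: nbhs_right_gt.
have inG : \forall z \near G, 0 <= z.1 /\ D z.2.
  by apply: filterS (withinT _ _) => z [/=]; rewrite in_itv/= andbT.
have Fz : F z.1 z.2 @[z --> G] --> within D (nbhs x).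
  apply: cvg_in_within.
    rewrite -[X in _ --> nbhs X](semigroup0 hF Dx).
    by apply: jF => //=; rewrite in_itv/= lexx.
  by apply: filterS inG => z [z1 Dz]; exact: (semigroup_in hF).
have a_cvg := cvg_comp _ _ Fz (semicocycle_within hGamC (ltW u0) Dx).
have b_cvg : Gam (z.1 + u) z.2 @[z --> G] --> Gam u x.
  (* Shifting by [- u] moves the base time 0 to [u > 0], where joint continuity is already
     established. *)
  have sh := @cvg_shift_within R X D 0 (- u) x.
  rewrite sub0r opprK in sh.
  apply: cvg_prod_within.
  exact: cvg_comp sh (semicocycle_joint hF hGamC hGam u0 Dx).
have near_a : \forall z \near G, `|1 - Gam u (F z.1 z.2)| < 2^-1.
  have aB : 1 - Gam u (F z.1 z.2) @[z --> G] --> 1 - Gam u x.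
    by apply: cvgB a_cvg; exact: cvg_cst.
  exact: cvgr_norm_lt aB _ u1.
have near_ab e : 0 < e ->
    \forall z \near G, `|Gam u (F z.1 z.2) - Gam (z.1 + u) z.2| < e.
  by apply: (cvgr0Pnorm_lt _).1; rewrite -(subrr (Gam u x)); exact: cvgB a_cvg b_cvg.
apply/cvgrPdist_lt => e e0; near=> z.
set a := Gam u (F z.1 z.2); set b := Gam (z.1 + u) z.2; set g := Gam z.1 z.2.
have [z0 Dz] : 0 <= z.1 /\ D z.2 by near: z.
have abg : a * g = b by case: hGam => GA _; rewrite /a /g GA ?(ltW u0)// addrC.
have a1 : `|1 - a| <= 2^-1.
  by apply: ltW; rewrite /a; near: z; exact: near_a.
have ab : `|a - b| < e / 2.
  by rewrite /a /b; near: z; apply: near_ab; rewrite divr_gt0.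
(* With [a * g = b], [1 - g = (a - b) + (1 - a) * (1 - g)], so that no inverse of
   [a] is needed. *)
have g1 : 1 - g = (a - b) + (1 - a) * (1 - g).
  by rewrite mulrBl mul1r mulrBr mulr1 abg [RHS]addrC subrK.
have : `|1 - g| <= `|a - b| + 2^-1 * `|1 - g|.
  rewrite {1}g1 (le_trans (ler_normD _ _))// lerD2l.
  by rewrite (le_trans (banach_normM _ _))// ler_wpM2r.
rewrite -lerBlDr => gab.
have : `|1 - g| / 2 < e / 2.
  apply: le_lt_trans ab; apply: le_trans gab.
  by rewrite {2}(splitr `|1 - g|) mulrC addrK.
by rewrite ltr_pM2r.
Unshelve. all: by end_near. Qed.
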